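(* For each guarded recursive specification $E$ over pACPpSI and each $X\in\mathrm{vars}(E)$, there exists a guarded recursive specification $E'$ over pACP such that the equation $\langle X|E\rangle=\langle X|E'\rangle$ is derivable from the axioms of pACPpSIr.
   Context: Meadow and probabilities. Fix a signed cancellation meadow $M$: a commutative ring with identity $1$ equipped with a total unary operation $x^{-1}$ satisfying $(x^{-1})^{-1}=x$ and $x\cdot(x\cdot x^{-1})=x$ (so $0^{-1}=0$), satisfying the cancellation axiom $x\neq0\wedge x\cdot y=x\cdot z\Rightarrow y=z$, expanded with a signum operation $\mathrm{s}$ satisfying $\mathrm{s}(x/x)=x/x$, $\mathrm{s}(1-x/x)=1-x/x$, $\mathrm{s}(-1)=-1$, $\mathrm{s}(x^{-1})=\mathrm{s}(x)$, $\mathrm{s}(xy)=\mathrm{s}(x)\mathrm{s}(y)$, $\bigl(1-\frac{\mathrm{s}(x)-\mathrm{s}(y)}{\mathrm{s}(x)-\mathrm{s}(y)}\bigr)(\mathrm{s}(x+y)-\mathrm{s}(x))=0$, with $x/y=x\cdot y^{-1}$. $\mathrm{Prob}=\{\pi\in M:\mathrm{s}(\mathrm{s}(\pi)+1)\cdot\mathrm{s}(\mathrm{s}(1-\pi)+1)=1\}$. Actions: a set $A$, $\delta\notin A$, $A_\delta=A\cup\{\delta\}$, and a commutative associative $\gamma:A_\delta\times A_\delta\to A_\delta$ with $\gamma(\delta,a)=\delta$. pACP: terms built from variables in a countably infinite set $\mathcal X$, constants $a$ ($a\in A$) and $\delta$, binary operators $+$, $\cdot$, $\oplus_\pi$ ($\pi\in\mathrm{Prob}$),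 $\parallel$, $\lfloor\!\lfloor$ (left merge), $\mid$ (communication merge), unary $\partial_H$ ($H\subseteq A$). Axioms ($a,b$ range over $A\cup\{\delta\}$ as constants, $\gamma(a,b)$ is the constant for that element, $H\subseteq A$, $\pi,\rho\in\mathrm{Prob}$): A1 $x+y=y+x$; A2 $(x+y)+z=x+(y+z)$; A3' $a+a=a$; A4 $(x+y)\cdot z=x\cdot z+y\cdot z$; A5 $(x\cdot y)\cdot z=x\cdot(y\cdot z)$; A6 $x+\delta=x$; A7 $\delta\cdot x=\delta$; D1 $\partial_H(a)=a$ if $a\notin H$; D2 $\partial_H(a)=\delta$ if $a\in H$; D3 $\partial_H(x+y)=\partial_H(x)+\partial_H(y)$; D4 $\partial_H(x\cdot y)=\partial_H(x)\cdot\partial_H(y)$; pA1 $x\oplus_\pi y=y\oplus_{1-\pi}x$; pA2 $(x\oplus_\pi y)\oplus_\rho z=x\oplus_{\pi\rho}(y\oplus_{\frac{(1-\pi)\rho}{1-\pi\rho}}z)$; pA3 $x\oplus_\pi x=x$; pA4 $(x\oplus_\pi y)\cdot z=x\cdot z\oplus_\pi y\cdot z$; pA5 $(x\oplus_\pi y)+z=(x+z)\oplus_\pi(y+z)$; pA6 $x\oplus_1y=x$; CM1' $x=x+x\wedge y=y+y\Rightarrow x\parallel y=x\lfloor\!\lfloor y+y\lfloor\!\lfloor x+x\mid y$; CM2 $a\lfloor\!\lfloor x=a\cdot x$; CM3 $a\cdot x\lfloor\!\lfloor y=a\cdot(x\parallel y)$; CM4 $(x+y)\lfloor\!\lfloor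 z=x\lfloor\!\lfloor z+y\lfloor\!\lfloor z$; CM5 $a\cdot x\mid b=\gamma(a,b)\cdot x$; CM6 $a\mid b\cdot x=\gamma(a,b)\cdot x$; CM7 $a\cdot x\mid b\cdot y=\gamma(a,b)\cdot(x\parallel y)$; CM8 $(x+y)\mid z=x\mid z+y\mid z$; CM9 $x\mid(y+z)=x\mid y+x\mid z$; CM10 $\delta\mid x=\delta$; CM11 $x\mid\delta=\delta$; CM12 $a\mid b=\gamma(a,b)$; pCM1 $(x\oplus_\pi y)\parallel z=(x\parallel z)\oplus_\pi(y\parallel z)$; pCM2 $x\parallel(y\oplus_\pi z)=(x\parallel y)\oplus_\pi(x\parallel z)$; pCM3 $(x\oplus_\pi y)\lfloor\!\lfloor z=(x\lfloor\!\lfloor z)\oplus_\pi(y\lfloor\!\lfloor z)$; pCM4 $x\lfloor\!\lfloor(y\oplus_\pi z)=(x\lfloor\!\lfloor y)\oplus_\pi(x\lfloor\!\lfloor z)$; pCM5 $(x\oplus_\pi y)\mid z=(x\mid z)\oplus_\pi(y\mid z)$; pCM6 $x\mid(y\oplus_\pi z)=(x\mid y)\oplus_\pi(x\mid z)$; pD $\partial_H(x\oplus_\pi y)=\partial_H(x)\oplus_\pi\partial_H(y)$. Notation: for $n\ge1$ and $\pi_1,\dots,\pi_n\in\mathrm{Prob}$ summing to $1$, $\bigoplus_{i=1}^{1}[\pi_i]\,t_i=t_1$ and $\bigoplus_{i=1}^{n+1}[\pi_i]\,t_i=t_1\oplus_{\pi_1}\bigl(\bigoplus_{i=1}^{n}[\pi_{i+1}/(1-\pi_1)]\,t_{i+1}\bigr)$.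 $\mathbb N^+$ is the set of positive naturals. For sequences, $\langle\rangle$ is the empty sequence and $h\frown u$ is concatenation. Interleaving histories: for $n\in\mathbb N^+$, $\mathrm{Hist}_n\subseteq(\mathbb N^+\times\mathbb N^+)^*$ is inductively defined by: $\langle\rangle\in\mathrm{Hist}_n$; if $i\le n$ then $\langle i,n\rangle\in\mathrm{Hist}_n$; if $h\frown\langle i,n\rangle\in\mathrm{Hist}_n$, $j\le n$ and $n-1\le m\le n+1$ then $h\frown\langle i,n\rangle\frown\langle j,m\rangle\in\mathrm{Hist}_m$. Interleaving strategy data: a set $S$ (control states); for each $n\in\mathbb N^+$ a partial function $\mathrm{sched}_n:\mathrm{Hist}_n\times S\rightharpoonup(\{1,\dots,n\}\to\mathrm{Prob})$ with $\sum_{i=1}^n\mathrm{sched}_n(h,s)(i)=1$ whenever defined; a total function $\mathrm{updat}_n:\mathrm{Hist}_n\times S\times\{1,\dots,n\}\times A\times\{0,1\}\to S$; a set $C\subset A$ (control actions) with $\mathrm{updat}_n(h,s,i,a,0)=s$ for $a\in A\setminus C$, such that for each $c\in C$ there is $\bar c\in A\setminus C$, and for all $a,b\in A$: $\gamma(a,b)\neq c$, $\gamma(a,b)\neq\bar c$, $\gamma(a,c)=\delta$, $\gamma(a,\bar c)=\delta$. Also a set $D$ of data, actions $\mathrm{pcr}(d),\mathrm{rcr}(d)\in A$ for $d\in D$ with $\gamma(\mathrm{pcr}(d),a)=\delta$ and $\gamma(a,b)\neq\mathrm{pcr}(d)$ for all $a,b\in A$, and a function $\mathrm{crea}$ from $D$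 to the set of closed pACPpSI terms. pACPpSI: the signature of pACP extended with, for each $n\in\mathbb N^+$, $h\in\mathrm{Hist}_n$, $s\in S$, an $n$-ary operator $\|^n_{h,s}$ (strategic interleaving), and for each $i\le n$ an $n$-ary operator $\|^n_{i,h,s}$ (positional strategic interleaving). Its axioms are those of pACP plus the following, where $a$ ranges over constants $a\in A$ not of the form $\mathrm{pcr}(d)$ or $\mathrm{rcr}(d)$, and $d\in D$: SI0': $x_1=x_1+x_1\wedge\dots\wedge x_n=x_n+x_n\Rightarrow\|^n_{h,s}(x_1,\dots,x_n)=\delta$ if $\mathrm{sched}_n(h,s)$ is undefined; SI1': $x_1=x_1+x_1\wedge\dots\wedge x_n=x_n+x_n\Rightarrow\|^n_{h,s}(x_1,\dots,x_n)=\bigoplus_{i=1}^n[\mathrm{sched}_n(h,s)(i)]\,\|^n_{i,h,s}(x_1,\dots,x_n)$ if $\mathrm{sched}_n(h,s)$ is defined; SI2: $\|^n_{i,h,s}(x_1,\dots,x_{i-1},\delta,x_{i+1},\dots,x_n)=\delta$; SI3: $\|^1_{i,h,s}(a)=a$; SI4: $\|^{n+1}_{i,h,s}(x_1,\dots,x_{i-1},a,x_{i+1},\dots,x_{n+1})=a\cdot\|^n_{h\frown\langle i,n\rangle,\mathrm{updat}_{n+1}(h,s,i,a,1)}(x_1,\dots,x_{i-1},x_{i+1},\dots,x_{n+1})$; SI5: $\|^n_{i,h,s}(x_1,\dots,x_{i-1},a\cdot x_i',x_{i+1},\dots,x_n)=a\cdot\|^n_{h\frown\langle i,n\rangle,\mathrm{updat}_n(h,s,i,a,0)}(x_1,\dots,x_{i-1},x_i',x_{i+1},\dots,x_n)$;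 SI6: $\|^n_{i,h,s}(x_1,\dots,x_{i-1},\mathrm{pcr}(d),x_{i+1},\dots,x_n)=\mathrm{rcr}(d)\cdot\|^n_{h\frown\langle i,n\rangle,\mathrm{updat}_n(h,s,i,\mathrm{pcr}(d),1)}(x_1,\dots,x_{i-1},x_{i+1},\dots,x_n,\mathrm{crea}(d))$; SI7: $\|^n_{i,h,s}(x_1,\dots,x_{i-1},\mathrm{pcr}(d)\cdot x_i',x_{i+1},\dots,x_n)=\mathrm{rcr}(d)\cdot\|^{n+1}_{h\frown\langle i,n+1\rangle,\mathrm{updat}_n(h,s,i,\mathrm{pcr}(d),0)}(x_1,\dots,x_{i-1},x_i',x_{i+1},\dots,x_n,\mathrm{crea}(d))$; SI8: $\|^n_{i,h,s}(\dots,x_i'+x_i'',\dots)=\|^n_{i,h,s}(\dots,x_i',\dots)+\|^n_{i,h,s}(\dots,x_i'',\dots)$ (other arguments unchanged); pSI1: $\|^n_{h,s}(\dots,x_i'\oplus_\pi x_i'',\dots)=\|^n_{h,s}(\dots,x_i',\dots)\oplus_\pi\|^n_{h,s}(\dots,x_i'',\dots)$; pSI2: $\|^n_{i,h,s}(\dots,x_i'\oplus_\pi x_i'',\dots)=\|^n_{i,h,s}(\dots,x_i',\dots)\oplus_\pi\|^n_{i,h,s}(\dots,x_i'',\dots)$. Guarded recursion over a theory $T\in\{\text{pACP},\text{pACPpSI}\}$: an occurrence of a variable $X$ in a $T$ term $t$ is guarded if $t$ has a subterm $a\cdot t'$ with $a\in A$ and $t'$ containing that occurrence; $t$ is guarded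 if all its variable occurrences are. A recursive specification over $T$ is a set $E=\{X_i=t_i\mid i\in I\}$ ($I$ finite or countably infinite, distinct $X_i\in\mathcal X$, each $t_i$ a $T$ term with variables among the $X_i$); it is guarded if each $t_i$ can be rewritten to a guarded $T$ term using the axioms of $T$ in either direction and the equations $X_j=t_j$ ($j\neq i$) from left to right. $\mathrm{vars}(E)$ is its set of variables. pACPpSIr extends pACPpSI with a constant $\langle X|E\rangle$ for each guarded recursive specification $E$ over pACPpSI and $X\in\mathrm{vars}(E)$, with axioms RDP: $\langle X|E\rangle=\langle t|E\rangle$ if $X=t\in E$ (where $\langle t|E\rangle$ is $t$ with each $Y\in\mathrm{vars}(E)$ replaced by $\langle Y|E\rangle$), and RSP: $E\Rightarrow X=\langle X|E\rangle$ if $X\in\mathrm{vars}(E)$. Guarded recursive specifications over pACP are in particular over pACPpSI, so their constants are also available. Derivations use infinitary conditional equational logic.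
   Formalization: SI3–SI5 are also taken for the actions rcr(d) (otherwise no axiom determines a positional interleaving whose scheduled process is rcr(d), and the claim fails), and ⟨i,n⟩ is in Hist_n for i ≤ n+1, not only i ≤ n, so that SI4 with empty history and i = n+1 is well formed. *)

(* Defs.v *)
From HB Require Import structures.
From mathcomp Require Import all_boot all_algebra.
From mathcomp Require Import ring zify.

Set Implicit Arguments.
Unset Strict Implicit.
Unset Printing Implicit Defensive.

Import GRing.Theory.
Local Open Scope ring_scope.

(* [1 <> 0] is not required, hence [comPzRingType] rather than
   [comNzRingType]. *)
Record signedMeadow := SignedMeadow {
  meadow_ring :> comPzRingType;
  minv : meadow_ring -> meadow_ring;
  sgn : meadow_ring -> meadow_ring;
  minvK : forall x, minv (minv x) = x;
  mulmV : forall x : meadow_ring, x * (x * minv x) = x;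
  meadow_cancel : forall x y z : meadow_ring, x <> 0 -> x * y = x * z -> y = z;
  sgn_div : forall x : meadow_ring, sgn (x * minv x) = x * minv x;
  sgn_cdiv : forall x : meadow_ring, sgn (1 - x * minv x) = 1 - x * minv x;
  sgnN1 : sgn (-1) = -1;
  sgnV : forall x, sgn (minv x) = sgn x;
  sgnM : forall x y : meadow_ring, sgn (x * y) = sgn x * sgn y;
  sgnD : forall x y : meadow_ring,
    (1 - (sgn x - sgn y) * minv (sgn x - sgn y)) * (sgn (x + y) - sgn x) = 0
}.

Definition isProb (M : signedMeadow) (p : M) : bool :=
  sgn (sgn p + 1) * sgn (sgn (1 - p) + 1) == 1.

Definition Prob (M : signedMeadow) := {p : M | isProb p}.

Section MeadowTheory.
Variable M : signedMeadow.
Implicit Types x y : M.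

Lemma mulfV x : x <> 0 -> x * minv x = 1.
Proof. by move=> x0; apply: (meadow_cancel x0); rewrite mulmV mulr1. Qed.

Lemma minv0 : minv 0 = 0 :> M.
Proof. by rewrite -(mulmV (minv 0)) minvK !mulr0. Qed.

Lemma sgn0 : sgn 0 = 0 :> M.
Proof. by have := @sgn_div M 0; rewrite mul0r. Qed.

Lemma sgn1 : sgn 1 = 1 :> M.
Proof. by have := @sgn_cdiv M 0; rewrite mul0r subr0. Qed.

Lemma sgnN x : sgn (- x) = - sgn x.
Proof. by rewrite -mulN1r sgnM sgnN1 mulN1r. Qed.

Lemma sgn_eqD x y : sgn x = sgn y -> sgn (x + y) = sgn x.
Proof.
move=> e; have := sgnD x y.
by rewrite e subrr mul0r subr0 mul1r => /eqP; rewrite subr_eq0 => /eqP.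
Qed.

Lemma mmul_eq0 x y : x * y = 0 -> x = 0 \/ y = 0.
Proof.
move=> e; have [->|/eqP x0] := eqVneq x 0; first by left.
by right; apply: (meadow_cancel x0); rewrite e mulr0.
Qed.

Lemma sgn_cases x : [\/ x = 0, sgn x = 1 | sgn x = -1].
Proof.
have [->|/eqP x0] := eqVneq x 0; first by constructor 1.
have e : (sgn x - 1) * (sgn x + 1) = 0.
  have : sgn x * sgn x = 1 by rewrite -{2}sgnV -sgnM mulfV // sgn1.
  by move=> e; transitivity (sgn x * sgn x - 1); [ring | rewrite e subrr].
case: (mmul_eq0 e) => /eqP.
  by rewrite subr_eq0 => /eqP; constructor 2.
by rewrite addr_eq0 => /eqP; constructor 3.
Qed.

Hypothesis nz : (1 : M) <> 0.

Lemma one_neqN1 : (1 : M) <> -1.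
Proof.
move=> e; apply: nz; have := @sgn_eqD 1 1 (erefl _).
by rewrite {2}e subrr sgn0 sgn1.
Qed.

Definition nn x := sgn x <> -1.

Lemma nnP x : nn x -> x = 0 \/ sgn x = 1.
Proof. by case: (sgn_cases x) => [->|->|//]; [left|right]. Qed.

Lemma nn0 : nn 0.
Proof. by rewrite /nn sgn0 => /eqP; rewrite eq_sym oppr_eq0 => /eqP. Qed.

Lemma sgn1_nn x : sgn x = 1 -> nn x.
Proof. by rewrite /nn => ->; apply: one_neqN1. Qed.

Lemma nnD x y : nn x -> nn y -> nn (x + y).
Proof.
move=> /nnP[-> hy|ex]; first by rewrite add0r.
move=> /nnP[->|ey]; first by rewrite addr0; apply: sgn1_nn.
by apply: sgn1_nn; rewrite sgn_eqD // ex ey.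
Qed.

Lemma nnM x y : nn x -> nn y -> nn (x * y).
Proof.
move=> /nnP[-> hy|ex]; first by rewrite mul0r; apply: nn0.
move=> /nnP[->|ey]; first by rewrite mulr0; apply: nn0.
by apply: sgn1_nn; rewrite sgnM ex ey mulr1.
Qed.

Lemma nnV x : nn x -> nn (minv x).
Proof. by rewrite /nn sgnV. Qed.

Lemma nn_anti x : nn x -> nn (- x) -> x = 0.
Proof. by move=> /nnP[//|ex]; rewrite /nn sgnN ex. Qed.

Lemma sgn_nn1 x : sgn (sgn x + 1) = if sgn x == -1 then 0 else 1.
Proof.
case: (sgn_cases x) => [->|->|->].
- by rewrite sgn0 add0r sgn1; case: eqP => // e; case: nn0; rewrite sgn0.
- by rewrite sgn_eqD ?sgn1 //; case: eqP => // e; case: one_neqN1.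
- by rewrite addNr sgn0 eqxx.
Qed.

Lemma isProbP x : isProb x <-> nn x /\ nn (1 - x).
Proof.
rewrite /isProb !sgn_nn1 /nn; split.
  by case: (sgn x =P -1) => ?; case: (sgn (1 - x) =P -1) => ?;
    rewrite ?(mul0r, mulr0) // => /eqP/esym.
by case=> /eqP/negbTE-> /eqP/negbTE->; rewrite mulr1.
Qed.

End MeadowTheory.

Lemma isProb_triv (M : signedMeadow) (x : M) : (1 : M) = 0 -> isProb x.
Proof. by move=> e; apply/eqP; rewrite -[LHS]mulr1 e mulr0. Qed.

Section ProbClosure.
Variable M : signedMeadow.
Implicit Types x y : M.

Lemma isProb0 : isProb (0 : M).
Proof.
have [/isProb_triv //|/eqP nz] := eqVneq (1 : M) 0.
apply/isProbP => //; split; first exact: nn0.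
by rewrite subr0; apply/sgn1_nn/sgn1.
Qed.

Lemma isProbC x : isProb x -> isProb (1 - x).
Proof.
have [/isProb_triv //|/eqP nz] := eqVneq (1 : M) 0.
by move=> /(isProbP nz)[? ?]; apply/(isProbP nz); rewrite subKr.
Qed.

Lemma isProb1 : isProb (1 : M).
Proof. by rewrite -[1]subr0 isProbC // isProb0. Qed.

Lemma isProbM x y : isProb x -> isProb y -> isProb (x * y).
Proof.
have [/isProb_triv //|/eqP nz] := eqVneq (1 : M) 0.
move=> /(isProbP nz)[x0 x1] /(isProbP nz)[y0 y1]; apply/(isProbP nz).
split; first exact: nnM.
have -> : 1 - x * y = (1 - x) + x * (1 - y) by ring.
by apply: nnD => //; apply: nnM.
Qed.

Lemma isProb_frac x y : (1 : M) <> 0 -> nn x -> nn (y - x) -> isProb (x * minv y).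
Proof.
move=> nz x0 xy; have [->|/eqP y0] := eqVneq y 0; first by rewrite minv0 mulr0 isProb0.
have ny : nn y by rewrite -(subrK x y); apply: nnD.
apply/(isProbP nz); split; first by apply: nnM => //; apply: nnV.
by rewrite -(mulfV y0) -mulrBl; apply: nnM => //; apply: nnV.
Qed.

Lemma isProb_assoc x y :
  isProb x -> isProb y -> isProb ((1 - x) * y * minv (1 - x * y)).
Proof.
have [/isProb_triv //|/eqP nz] := eqVneq (1 : M) 0.
move=> /(isProbP nz)[x0 x1] /(isProbP nz)[y0 y1].
apply: isProb_frac => //; first exact: nnM.
by have -> : 1 - x * y - (1 - x) * y = 1 - y by ring.
Qed.

End ProbClosure.

(* Total coercion into [Prob]: the default value is never reached, as shown by
   [isProbC], [isProbM], [isProb_assoc] and [renorm_ok]. *)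
Definition prob1 (M : signedMeadow) : Prob M := exist _ 1 (isProb1 M).
Definition toProb (M : signedMeadow) (p : M) : Prob M := insubd (prob1 M) p.

(* Terms over the signature of pACP extended with, for each [n], the [n]-ary
   operators in [O n].  The constants for [A] and [delta] are
   [act (Some a)] and [act None]; the set of variables is [nat].  *)
Inductive term (M : signedMeadow) (A : Type) (O : nat -> Type) : Type :=
| var of nat
| act of option A
| alt of term M A O & term M A O
| seqc of term M A O & term M A O
| pch of Prob M & term M A O & term M A O
| par of term M A O & term M A O
| lmerge of term M A O & term M A O
| cmerge of term M A O & term M A O
| encap of (A -> Prop) & term M A O
| op n of O n & ('I_n -> term M A O).

Arguments var {M A O}.
Arguments act {M A O}.
Arguments alt {M A O}.
Arguments seqc {M A O}.
Arguments pch {M A O}.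
Arguments par {M A O}.
Arguments lmerge {M A O}.
Arguments cmerge {M A O}.
Arguments encap {M A O}.
Arguments op {M A O n}.

Declare Scope proc_scope.
Delimit Scope proc_scope with proc.
Bind Scope proc_scope with term.
Notation "'delta'" := (act None) : proc_scope.
Notation "x + y" := (alt x y) : proc_scope.
Notation "x * y" := (seqc x y) : proc_scope.
Notation "x <+{ p } y" := (pch p x y)
  (at level 48, p at level 200, left associativity,
   format "x  <+{ p }  y") : proc_scope.
Notation "x ||| y" := (par x y) (at level 45, left associativity) : proc_scope.
Notation "x ||_ y" := (lmerge x y) (at level 45, left associativity) : proc_scope.
Notation "x |&| y" := (cmerge x y) (at level 45, left associativity) : proc_scope.

Section TermOps.
Variables (M : signedMeadow) (A : Type).

Fixpoint tsubst (O : nat -> Type) (sg : nat -> term M A O) (t : term M A O) :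
  term M A O :=
  match t with
  | var X => sg X
  | act a => act a
  | alt t u => alt (tsubst sg t) (tsubst sg u)
  | seqc t u => seqc (tsubst sg t) (tsubst sg u)
  | pch p t u => pch p (tsubst sg t) (tsubst sg u)
  | par t u => par (tsubst sg t) (tsubst sg u)
  | lmerge t u => lmerge (tsubst sg t) (tsubst sg u)
  | cmerge t u => cmerge (tsubst sg t) (tsubst sg u)
  | encap H t => encap H (tsubst sg t)
  | op _ o x => op o (fun i => tsubst sg (x i))
  end.

Definition subst1 (O : nat -> Type) (z : nat) (u : term M A O) : nat -> term M A O :=
  fun X => if X == z then u else var X.

Fixpoint tmap (O O' : nat -> Type) (f : forall n, O n -> O' n) (t : term M A O) :
  term M A O' :=
  match t with
  | var X => var X
  | act a => act a
  | alt t u => alt (tmap f t) (tmap f u)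
  | seqc t u => seqc (tmap f t) (tmap f u)
  | pch p t u => pch p (tmap f t) (tmap f u)
  | par t u => par (tmap f t) (tmap f u)
  | lmerge t u => lmerge (tmap f t) (tmap f u)
  | cmerge t u => cmerge (tmap f t) (tmap f u)
  | encap H t => encap H (tmap f t)
  | op n o x => op (f n o) (fun i => tmap f (x i))
  end.

Variable O : nat -> Type.
Implicit Types t u : term M A O.

Definition is_action t : bool := if t is act (Some _) then true else false.

(* [occurs X g t]: the variable [X] has an occurrence in [t]; the boolean [g]
   tells whether this occurrence is guarded, that is, lies in the right-hand
   operand [t'] of some subterm [a * t'] with [a] in [A]. *)
Inductive occurs (X : nat) : bool -> term M A O -> Prop :=
| occ_var : occurs X false (var X)
| occ_altl g t u : occurs X g t -> occurs X g (alt t u)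
| occ_altr g t u : occurs X g u -> occurs X g (alt t u)
| occ_seqcl g t u : occurs X g t -> occurs X g (seqc t u)
| occ_seqcr g t u : occurs X g u -> occurs X (is_action t || g) (seqc t u)
| occ_pchl g p t u : occurs X g t -> occurs X g (pch p t u)
| occ_pchr g p t u : occurs X g u -> occurs X g (pch p t u)
| occ_parl g t u : occurs X g t -> occurs X g (par t u)
| occ_parr g t u : occurs X g u -> occurs X g (par t u)
| occ_lmergel g t u : occurs X g t -> occurs X g (lmerge t u)
| occ_lmerger g t u : occurs X g u -> occurs X g (lmerge t u)
| occ_cmergel g t u : occurs X g t -> occurs X g (cmerge t u)
| occ_cmerger g t u : occurs X g u -> occurs X g (cmerge t u)
| occ_encap g H t : occurs X g t -> occurs X g (encap H t)
| occ_op g n (o : O n) x i : occurs X g (x i) -> occurs X g (op o x).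

Definition closed t := forall X g, ~ occurs X g t.
Definition guarded t := forall X g, occurs X g t -> g.

End TermOps.

(* The notation \bigoplus_(i = 1)^(n + 1) [w i] (t i). *)
Fixpoint bigpch (M : signedMeadow) (A : Type) (O : nat -> Type) (n : nat) :
  ('I_n.+1 -> M) -> ('I_n.+1 -> term M A O) -> term M A O :=
  match n return ('I_n.+1 -> M) -> ('I_n.+1 -> term M A O) -> term M A O with
  | 0 => fun _ t => t ord0
  | n'.+1 => fun w t =>
      pch (toProb (w ord0)) (t ord0)
        (bigpch (fun i => w (lift ord0 i) * minv (1 - w ord0))
                (fun i => t (lift ord0 i)))
  end.

(* The weights met when [bigpch] recurses stay in [Prob].  If [w ord0 = 1],
   the remaining weights all become 0, as [0 / 0 = 0] in a meadow. *)
Definition weights_ok (M : signedMeadow) n (w : 'I_n -> M) : Prop :=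
  (forall i, isProb (w i)) /\ (\sum_i w i = 1 \/ forall i, w i = 0).

Lemma renorm_ok (M : signedMeadow) n (w : 'I_n.+1 -> M) :
  weights_ok w -> weights_ok (fun i => w (lift ord0 i) * minv (1 - w ord0)).
Proof.
move=> [wP w1].
have [e|/eqP nz] := eqVneq (1 : M) 0.
  split=> [i|]; first exact: isProb_triv.
  by right=> i; rewrite -[LHS]mulr1 e mulr0.
case: w1 => [w1|w0]; last first.
  by split=> [i|]; [|right=> i]; rewrite w0 mul0r ?isProb0.
have e : 1 - w ord0 = \sum_i w (lift ord0 i).
  by rewrite -w1 big_ord_recl addrC addKr.
have wn i : nn (w i) by have /(isProbP nz)[] := wP i.
split=> [i|].
  apply: isProb_frac => //; rewrite e (bigD1 i) //=.
  rewrite [X in nn X]addrC addKr.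
  by elim/big_ind: _ => [|x y|j _]; [exact: nn0 | exact: nnD | exact: wn].
have [e0|/eqP ne0] := eqVneq (1 - w ord0) 0.
  by right=> i; rewrite e0 minv0 mulr0.
by left; rewrite -mulr_suml -e mulfV.
Qed.

Section Derivability.
Variables (M : signedMeadow) (A : Type) (O : nat -> Type).
Local Notation T := (term M A O).

(* A set of conditional equations: [Ax P l r] stands for [P => l = r], where
   the possibly infinite set of premises [P] is a binary relation on terms.
   All axiom sets below are closed under substitution: they list every
   substitution instance of the axioms. *)
Definition axioms := (T -> T -> Prop) -> T -> T -> Prop.

Inductive derivable (Ax : axioms) : T -> T -> Prop :=
| d_refl t : derivable Ax t t
| d_sym t u : derivable Ax t u -> derivable Ax u t
| d_trans t u v : derivable Ax t u -> derivable Ax u v -> derivable Ax t v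
| d_alt t t' u u' : derivable Ax t t' -> derivable Ax u u' ->
    derivable Ax (alt t u) (alt t' u')
| d_seqc t t' u u' : derivable Ax t t' -> derivable Ax u u' ->
    derivable Ax (seqc t u) (seqc t' u')
| d_pch p t t' u u' : derivable Ax t t' -> derivable Ax u u' ->
    derivable Ax (pch p t u) (pch p t' u')
| d_par t t' u u' : derivable Ax t t' -> derivable Ax u u' ->
    derivable Ax (par t u) (par t' u')
| d_lmerge t t' u u' : derivable Ax t t' -> derivable Ax u u' ->
    derivable Ax (lmerge t u) (lmerge t' u')
| d_cmerge t t' u u' : derivable Ax t t' -> derivable Ax u u' ->
    derivable Ax (cmerge t u) (cmerge t' u')
| d_encap H t t' : derivable Ax t t' -> derivable Ax (encap H t) (encap H t')
| d_op n (o : O n) x y : (forall i, derivable Ax (x i) (y i)) ->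
    derivable Ax (op o x) (op o y)
| d_ax (P : T -> T -> Prop) l r : Ax P l r ->
    (forall u v, P u v -> derivable Ax u v) -> derivable Ax l r.

Definition noprem : T -> T -> Prop := fun _ _ => False.

(* The premises [x i = x i + x i], for all [i]. *)
Definition idem (I : Type) (x : I -> T) : T -> T -> Prop :=
  fun u v => exists i, u = x i /\ v = alt (x i) (x i).

End Derivability.

Arguments noprem {M A O}.

(* [option A] is the set of actions with [None] as [delta]. *)
Record commFun (A : Type) := CommFun {
  gamma :> option A -> option A -> option A;
  gammaC : forall a b, gamma a b = gamma b a;
  gammaA : forall a b c, gamma a (gamma b c) = gamma (gamma a b) c;
  gamma_delta : forall a, gamma None a = None
}.

Section PACP.
Variables (M : signedMeadow) (A : Type) (ga : commFun A) (O : nat -> Type).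
Implicit Types (x y z : term M A O) (a b : option A) (H : A -> Prop)
  (p q : Prob M).

Definition in_enc H a : Prop := if a is Some c then H c else False.

Local Open Scope proc_scope.

Inductive pACP_ax : axioms M A O :=
| A1 x y : pACP_ax noprem (x + y) (y + x)
| A2 x y z : pACP_ax noprem ((x + y) + z) (x + (y + z))
| A3' a : pACP_ax noprem (act a + act a) (act a)
| A4 x y z : pACP_ax noprem ((x + y) * z) (x * z + y * z)
| A5 x y z : pACP_ax noprem ((x * y) * z) (x * (y * z))
| A6 x : pACP_ax noprem (x + delta) x
| A7 x : pACP_ax noprem (delta * x) delta
| D1 H a : ~ in_enc H a -> pACP_ax noprem (encap H (act a)) (act a)
| D2 H a : in_enc H a -> pACP_ax noprem (encap H (act a)) delta
| D3 H x y : pACP_ax noprem (encap H (x + y)) (encap H x + encap H y)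
| D4 H x y : pACP_ax noprem (encap H (x * y)) (encap H x * encap H y)
| pA1 p x y : pACP_ax noprem (x <+{p} y) (y <+{toProb (1 - val p)%R} x)
| pA2 p q x y z : pACP_ax noprem ((x <+{p} y) <+{q} z)
    (x <+{toProb (val p * val q)%R}
      (y <+{toProb ((1 - val p) * val q * minv (1 - val p * val q))%R} z))
| pA3 p x : pACP_ax noprem (x <+{p} x) x
| pA4 p x y z : pACP_ax noprem ((x <+{p} y) * z) ((x * z) <+{p} (y * z))
| pA5 p x y z : pACP_ax noprem ((x <+{p} y) + z) ((x + z) <+{p} (y + z))
| pA6 x y : pACP_ax noprem (x <+{prob1 M} y) x
| CM1' x y : pACP_ax (idem (fun b : bool => if b then x else y))
    (x ||| y) ((x ||_ y + y ||_ x) + x |&| y)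
| CM2 a x : pACP_ax noprem (act a ||_ x) (act a * x)
| CM3 a x y : pACP_ax noprem ((act a * x) ||_ y) (act a * (x ||| y))
| CM4 x y z : pACP_ax noprem ((x + y) ||_ z) (x ||_ z + y ||_ z)
| CM5 a b x : pACP_ax noprem ((act a * x) |&| act b) (act (ga a b) * x)
| CM6 a b x : pACP_ax noprem (act a |&| (act b * x)) (act (ga a b) * x)
| CM7 a b x y :
    pACP_ax noprem ((act a * x) |&| (act b * y)) (act (ga a b) * (x ||| y))
| CM8 x y z : pACP_ax noprem ((x + y) |&| z) (x |&| z + y |&| z)
| CM9 x y z : pACP_ax noprem (x |&| (y + z)) (x |&| y + x |&| z)
| CM10 x : pACP_ax noprem (delta |&| x) delta
| CM11 x : pACP_ax noprem (x |&| delta) delta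
| CM12 a b : pACP_ax noprem (act a |&| act b) (act (ga a b))
| pCM1 p x y z : pACP_ax noprem ((x <+{p} y) ||| z) ((x ||| z) <+{p} (y ||| z))
| pCM2 p x y z : pACP_ax noprem (x ||| (y <+{p} z)) ((x ||| y) <+{p} (x ||| z))
| pCM3 p x y z : pACP_ax noprem ((x <+{p} y) ||_ z) ((x ||_ z) <+{p} (y ||_ z))
| pCM4 p x y z : pACP_ax noprem (x ||_ (y <+{p} z)) ((x ||_ y) <+{p} (x ||_ z))
| pCM5 p x y z : pACP_ax noprem ((x <+{p} y) |&| z) ((x |&| z) <+{p} (y |&| z))
| pCM6 p x y z : pACP_ax noprem (x |&| (y <+{p} z)) ((x |&| y) <+{p} (x |&| z))
| pD H p x y :
    pACP_ax noprem (encap H (x <+{p} y)) (encap H x <+{p} encap H y).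

End PACP.

Definition noop (n : nat) : Type := void.
Definition noopE (O : nat -> Type) n (o : noop n) : O n := of_void _ o.

(* In a pair [(i, n)], [n] is the number of processes left after the [i]-th
   process (counted from 1) has been scheduled.

   One-step histories [(i, n)] are admitted for [i <= n.+1], not only for
   [i <= n]: if, with the empty history, the last of [n.+1] processes is
   scheduled and terminates, then the new history required by [SI4] is
   [(n.+1, n)].  After a nonempty history, the last clause admits that step. *)
Inductive hist : nat -> seq (nat * nat) -> Prop :=
| hist_nil n : (0 < n)%N -> hist n [::]
| hist_one n i : (0 < n)%N -> (0 < i <= n.+1)%N -> hist n [:: (i, n)]
| hist_snoc n m i j h : hist n (rcons h (i, n)) ->
    (0 < j <= n)%N -> (0 < m)%N -> (n.-1 <= m <= n.+1)%N ->
    hist m (rcons (rcons h (i, n)) (j, m)).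

Record history (n : nat) := History { hseq :> seq (nat * nat); _ : hist n hseq }.

Lemma hist_last n h i m : hist n (rcons h (i, m)) -> m = n.
Proof.
suff H k : hist n k -> (last (0, n)%N k).2 = n by move=> /H; rewrite last_rcons.
by case=> *; rewrite ?last_rcons.
Qed.

Lemma hist_rcons n m (h : history n) (i : 'I_n) : (0 < m)%N ->
  (n.-1 <= m <= n.+1)%N -> hist m (rcons h (i.+1, m)).
Proof.
case: h => h /= hh m0 nm; have := ltn_ord i.
case/lastP: h hh => [|h [j k]] hh lti.
  by apply: hist_one => //=; lia.
by have ek := hist_last hh; subst k; apply: hist_snoc.
Qed.

Section Extend.
Variable n : nat.
Implicit Types (h : history n.+1) (i : 'I_n.+1).

Lemma hist_keep h i : hist n.+1 (rcons h (i.+1, n.+1)%N).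
Proof. by apply: hist_rcons; lia. Qed.

Lemma hist_incr h i : hist n.+2 (rcons h (i.+1, n.+2)%N).
Proof. by apply: hist_rcons; lia. Qed.

Lemma hist_decr (h : history n.+2) (i : 'I_n.+2) : hist n.+1 (rcons h (i.+1, n.+1)%N).
Proof. by apply: hist_rcons; lia. Qed.

(* The history extended with the scheduling of [i], the number of processes
   being left unchanged, incremented or decremented by the step. *)
Definition hkeep h i : history n.+1 := History (hist_keep h i).
Definition hincr h i : history n.+2 := History (hist_incr h i).
Definition hdecr (h : history n.+2) (i : 'I_n.+2) : history n.+1 :=
  History (hist_decr h i).

End Extend.

(* Arities are positive: [SIop h s] and [PSIop i h s] are the strategic
   interleaving operators ||^(n+1)_(h, s) and ||^(n+1)_(i, h, s). *)
Inductive siop (S : Type) : nat -> Type :=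
| SIop n (h : history n.+1) (s : S) : siop S n.+1
| PSIop n (i : 'I_n.+1) (h : history n.+1) (s : S) : siop S n.+1.

(* The last argument of [updat] is [true] for 1 and [false] for 0. *)
Record strategy (M : signedMeadow) (A : Type) (ga : commFun A) := Strategy {
  cstate : Type;
  sched : forall n, history n.+1 -> cstate -> option ('I_n.+1 -> Prob M);
  sched_sum : forall n (h : history n.+1) s f,
    sched h s = Some f -> \sum_i val (f i) = 1;
  updat : forall n, history n.+1 -> cstate -> 'I_n.+1 -> A -> bool -> cstate;
  ctrl : A -> Prop;
  updat_noctrl : forall n (h : history n.+1) s i a,
    ~ ctrl a -> updat h s i a false = s;
  ctrl_bar : forall c, ctrl c -> exists2 c', ~ ctrl c' &
    forall a b : A, [/\ ga (Some a) (Some b) <> Some c,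
                        ga (Some a) (Some b) <> Some c',
                        ga (Some a) (Some c) = None &
                        ga (Some a) (Some c') = None];
  data : Type;
  pcr : data -> A;
  rcr : data -> A;
  pcr_comm : forall d a, ga (Some (pcr d)) (Some a) = None;
  pcr_nocomm : forall d a b, ga (Some a) (Some b) <> Some (pcr d);
  crea : data -> term M A (siop cstate);
  crea_closed : forall d, closed (crea d)
}.

Definition upd (T : Type) n (x : 'I_n -> T) (i : 'I_n) (u : T) : 'I_n -> T :=
  fun j => if j == i then u else x j.
Definition remove (T : Type) n (x : 'I_n.+1 -> T) (i : 'I_n.+1) : 'I_n -> T :=
  fun j => x (lift i j).
Definition append (T : Type) n (x : 'I_n -> T) (u : T) : 'I_n.+1 -> T :=
  fun j => if unlift ord_max j is Some k then x k else u.

Section PSI.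
Variables (M : signedMeadow) (A : Type) (ga : commFun A) (st : strategy M ga).
Variables (O : nat -> Type) (emb : forall n, siop (cstate st) n -> O n).
Local Notation T := (term M A O).

Definition si n (h : history n.+1) s (x : 'I_n.+1 -> T) : T :=
  op (emb (SIop h s)) x.
Definition psi n (i : 'I_n.+1) (h : history n.+1) s (x : 'I_n.+1 -> T) : T :=
  op (emb (PSIop i h s)) x.

Local Notation actA a := (act (Some a)).
Local Notation creat d := (tmap emb (crea d)).

(* The actions to which [SI3], [SI4] and [SI5] apply: all those to which [SI6]
   and [SI7] do not.  In particular the actions [rcr d] are included.  With the
   side condition that [a] is neither of the form [pcr d] nor of the form
   [rcr d], no axiom would apply to [psi i h s x] if [x i] is
   [actA (rcr d)]: both [actA (rcr d)] and [delta] would be possible values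
   of [psi ord0 h s (fun=> actA (rcr d))], so that this closed term would not
   be derivably equal to any term without strategic interleaving operators. *)
Definition plain (a : A) : Prop := forall d : data st, a <> pcr d.

Local Open Scope proc_scope.

Inductive SI_ax : axioms M A O :=
| SI0' n (h : history n.+1) s x : sched h s = None ->
    SI_ax (idem x) (si h s x) delta
| SI1' n (h : history n.+1) s x f : sched h s = Some f ->
    SI_ax (idem x) (si h s x)
      (bigpch (fun i => val (f i)) (fun i => psi i h s x))
| SI2 n i (h : history n.+1) s x :
    SI_ax noprem (psi i h s (upd x i delta)) delta
| SI3 i (h : history 1) s a : plain a ->
    SI_ax noprem (psi i h s (fun=> actA a)) (actA a)
| SI4 n i (h : history n.+2) s x a : plain a ->
    SI_ax noprem (psi i h s (upd x i (actA a)))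
      (actA a * si (hdecr h i) (updat h s i a true) (remove x i))
| SI5 n i (h : history n.+1) s x a x' : plain a ->
    SI_ax noprem (psi i h s (upd x i (actA a * x')))
      (actA a * si (hkeep h i) (updat h s i a false) (upd x i x'))
| SI6 n i (h : history n.+1) s x (d : data st) :
    SI_ax noprem (psi i h s (upd x i (actA (pcr d))))
      (actA (rcr d) * si (hkeep h i) (updat h s i (pcr d) true)
                         (append (remove x i) (creat d)))
| SI7 n i (h : history n.+1) s x (d : data st) x' :
    SI_ax noprem (psi i h s (upd x i (actA (pcr d) * x')))
      (actA (rcr d) * si (hincr h i) (updat h s i (pcr d) false)
                         (append (upd x i x') (creat d)))
| SI8 n i (h : history n.+1) s x x' x'' :
    SI_ax noprem (psi i h s (upd x i (x' + x'')))
      (psi i h s (upd x i x') + psi i h s (upd x i x''))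
| pSI1 n (i : 'I_n.+1) (h : history n.+1) s x p x' x'' :
    SI_ax noprem (si h s (upd x i (x' <+{p} x'')))
      (si h s (upd x i x') <+{p} si h s (upd x i x''))
| pSI2 n i (h : history n.+1) s x p x' x'' :
    SI_ax noprem (psi i h s (upd x i (x' <+{p} x'')))
      (psi i h s (upd x i x') <+{p} psi i h s (upd x i x'')).

Definition pACPpSI_ax : axioms M A O :=
  fun P l r => pACP_ax ga P l r \/ SI_ax P l r.

End PSI.

Section Recursion.
Variables (M : signedMeadow) (A : Type) (O : nat -> Type).
Local Notation T := (term M A O).
Implicit Types (E : nat -> option (term M A O)).

(* A set of equations [X = t] with distinct left-hand sides in a countable set
   of variables is a partial function from variables to terms. *)
Definition vars E (X : nat) : bool := isSome (E X).

Definition rec_spec E :=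
  forall X t, E X = Some t -> forall Y g, occurs Y g t -> vars E Y.

(* Rewriting with the axioms [Ax] in either direction (the premises of the
   conditional axioms being derivable from [Ax]) and with the equations of [E],
   except the one for [X], from left to right.  The variable [z] marks the
   place in the context [c] where the equation [Y = t] is applied. *)
Inductive rewrites (Ax : axioms M A O) E (X : nat) : T -> T -> Prop :=
| rw_ax t u : derivable Ax t u -> rewrites Ax E X t u
| rw_eqn c z Y t : Y <> X -> E Y = Some t ->
    rewrites Ax E X (tsubst (subst1 z (var Y)) c) (tsubst (subst1 z t) c)
| rw_trans t u v : rewrites Ax E X t u -> rewrites Ax E X u v ->
    rewrites Ax E X t v.

Definition guarded_spec (Ax : axioms M A O) E :=
  rec_spec E /\
  forall X t, E X = Some t -> exists2 u, rewrites Ax E X t u & guarded u.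

End Recursion.

Section Specs.
Variables (M : signedMeadow) (A : Type) (ga : commFun A) (st : strategy M ga).

Definition pACP_spec := nat -> option (term M A noop).
Definition pSI_spec := nat -> option (term M A (siop (cstate st))).

Definition pACP_guarded (E : pACP_spec) := guarded_spec (pACP_ax ga (O := noop)) E.
Definition pSI_guarded (E : pSI_spec) :=
  guarded_spec (pACPpSI_ax (st := st) (fun n o => o)) E.

Record recconst := RecConst {
  rc_spec : pSI_spec;
  rc_guarded : pSI_guarded rc_spec;
  rc_var : nat;
  rc_vars : vars rc_spec rc_var
}.

Inductive sirop : nat -> Type :=
| SIRop n (o : siop (cstate st) n) : sirop n
| Rec (c : recconst) : sirop 0.

Local Notation T := (term M A sirop).

Definition rec_term (E : pSI_spec) (gE : pSI_guarded E) X (vX : vars E X) : T :=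
  op (Rec (RecConst gE vX)) (fun i => var i).

(* <t|E> *)
Definition rec_subst (E : pSI_spec) (gE : pSI_guarded E)
    (t : term M A (siop (cstate st))) : T :=
  tsubst (fun Y => (if vars E Y as b return vars E Y = b -> T
                    then fun vY => rec_term gE vY
                    else fun _ => var Y) (erefl _))
         (tmap SIRop t).

Inductive rec_ax : axioms M A sirop :=
| RDP E (gE : pSI_guarded E) X (vX : vars E X) t : E X = Some t ->
    rec_ax noprem (rec_term gE vX) (rec_subst gE t)
| RSP E (gE : pSI_guarded E) X (vX : vars E X) (sg : nat -> T) :
    rec_ax (fun u v => exists Y t,
              [/\ E Y = Some t, u = sg Y & v = tsubst sg (tmap SIRop t)])
           (sg X) (rec_term gE vX).

Definition pACPpSIr_ax : axioms M A sirop :=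
  fun P l r => pACPpSI_ax SIRop P l r \/ rec_ax P l r.

Definition embed (E : pACP_spec) : pSI_spec :=
  fun X => omap (tmap (@noopE (siop (cstate st)))) (E X).

Lemma vars_embed E X : vars E X -> vars (embed E) X.
Proof. by rewrite /vars /embed; case: (E X). Qed.

Let em := tmap (M := M) (A := A) (@noopE (siop (cstate st))).

Lemma em_subst sg t : em (tsubst sg t) = tsubst (fun X => em (sg X)) (em t).
Proof.
rewrite /em; elim: t => [?|?|?|?|?|?|?|?|?|n o] /=; try by move=> *; congruence.
by case: (o : void).
Qed.

Lemma em_subst1 z u c :
  tsubst (fun X => em (subst1 z u X)) (em c) = tsubst (subst1 z (em u)) (em c).
Proof.
rewrite /em; elim: c => [X|?|?|?|?|?|?|?|?|n o] /=; try by move=> *; congruence.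
  by rewrite /subst1; case: eqP.
by case: (o : void).
Qed.

Lemma em_is_action t : is_action (em t) = is_action t.
Proof. by case: t. Qed.

Lemma em_occurs X g t : occurs X g (em t) -> occurs X g t.
Proof.
rewrite /em; elim: t g => /= [Y|a|t It u Iu|t It u Iu|p t It u Iu
  |t It u Iu|t It u Iu|t It u Iu|H t It|n []] g h; inversion h; subst;
  try by constructor; auto.
by rewrite em_is_action; constructor; auto.
Qed.

Lemma em_ax (P : term M A noop -> term M A noop -> Prop) l r : pACP_ax ga P l r ->
  pACP_ax ga noprem (em l) (em r) \/
  exists x y, P = idem (fun b : bool => if b then x else y) /\
  pACP_ax ga (idem (fun b : bool => if b then em x else em y)) (em l) (em r).
Proof.
by case=> *; try (by left; constructor); right; eexists; eexists; split;
  [reflexivity | constructor].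
Qed.

Lemma em_derivable t u : derivable (pACP_ax ga (O := noop)) t u ->
  derivable (pACPpSI_ax (st := st) (fun n o => o)) (em t) (em u).
Proof.
elim=> /= {t u}.
- by move=> t; apply: d_refl.
- by move=> t u _; apply: d_sym.
- by move=> t u v _ h1 _; apply: d_trans h1.
- by move=> t t' u u' _ h1 _; apply: d_alt.
- by move=> t t' u u' _ h1 _; apply: d_seqc.
- by move=> p t t' u u' _ h1 _; apply: d_pch.
- by move=> t t' u u' _ h1 _; apply: d_par.
- by move=> t t' u u' _ h1 _; apply: d_lmerge.
- by move=> t t' u u' _ h1 _; apply: d_cmerge.
- by move=> H t t' _; apply: d_encap.
- by move=> n o; case: (o : void).
move=> P l r /em_ax[h|[x [y [-> h]]]] _ IH.
- by apply: d_ax; [left; exact: h | ].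
- apply: d_ax; first by left; exact: h.
  by move=> _ _ [b [-> ->]]; have := IH _ _ (ex_intro _ b (conj erefl erefl));
    case: b.
Qed.

Lemma em_rewrites E X t u : rewrites (pACP_ax ga (O := noop)) E X t u ->
  rewrites (pACPpSI_ax (st := st) (fun n o => o)) (embed E) X (em t) (em u).
Proof.
elim=> {t u} [t u /em_derivable|c z Y t YX EY|t u v _ h1 _ h2].
- exact: rw_ax.
- by rewrite !em_subst !em_subst1; apply: rw_eqn; rewrite /embed ?EY.
- exact: rw_trans h1 h2.
Qed.

Lemma embed_guarded E : pACP_guarded E -> pSI_guarded (embed E).
Proof.
case=> rE gE; split=> X t'; rewrite /embed; case EX: (E X) => [t|//] [<-].
  by move=> Y g /em_occurs oY; apply/vars_embed/(rE _ _ EX _ _ oY).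
have [u ru gu] := gE _ _ EX; exists (em u); first exact: em_rewrites.
by move=> Y g /em_occurs; apply: gu.
Qed.

End Specs.

Arguments rec_term {M A ga st E} gE {X} vX.

(* Main.v *)
Require Import Defs.
From mathcomp Require Import all_boot all_algebra.
From Stdlib Require Import Classical FunctionalExtensionality IndefiniteDescription.

Set Implicit Arguments.
Unset Strict Implicit.
Unset Printing Implicit Defensive.

(** Let [W] be the set of terms built from the constants [<Y|E>] with the
    operators of pACPpSI.  Every term of [W] is derivably equal to a head normal
    form, that is, a probabilistic choice between sums of actions [a] and
    prefixes [a * t] with [t] again in [W]: head normal forms are closed under
    all operators, and guardedness of [E] provides one for each [<Y|E>].  As a
    head normal form has finitely many continuations [t], the terms reachable
    from [<X|E>] are indexed by finite paths, hence by natural numbers.  Their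
    head normal forms, with the continuations replaced by variables, make up a
    guarded recursive specification over pACP, of which these terms are a
    solution by construction; RSP concludes. *)

(** * Images of terms and axiom instances under operator renaming and substitution *)

Section Images.
Variables (M : signedMeadow) (A : Type) (O O' : nat -> Type).
Variables (f : forall n, O n -> O' n) (sg : nat -> term M A O').

(** With [SIRop] for [f], this is the shape of the right-hand sides in [rec_subst] and in the
    premises of [RSP]. *)
Definition timage (t : term M A O) : term M A O' := tsubst sg (tmap f t).

Lemma timage_bigpch n (w : 'I_n.+1 -> M) (t : 'I_n.+1 -> term M A O) :
  timage (bigpch w t) = bigpch w (fun i => timage (t i)).
Proof.
by elim: n w t => [//|n IHn] w t; apply: (congr1 (pch _ _)); apply: IHn.
Qed.

Lemma timage_upd n (x : 'I_n -> term M A O) i u :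
  (fun j => timage (upd x i u j)) = upd (fun j => timage (x j)) i (timage u).
Proof. by apply: functional_extensionality => j; rewrite /upd; case: eqP. Qed.

Lemma timage_append n (x : 'I_n -> term M A O) u :
  (fun j => timage (append x u j)) = append (fun j => timage (x j)) (timage u).
Proof.
by apply: functional_extensionality => j; rewrite /append; case: unlift.
Qed.

(** Needed for the terms [crea d] that [SI6] and [SI7] insert: being closed, they are unaffected by
    the substitution. *)
Lemma timage_tmap_closed (O0 : nat -> Type) (g : forall n, O0 n -> O n) t :
  Defs.closed t -> timage (tmap g t) = tmap (fun n o => f (g n o)) t.
Proof.
rewrite /timage.
elim: t => [Y|a|t It u Iu|t It u Iu|p t It u Iu|t It u Iu|t It u Iu|t It u Iu
  |H t It|n o x Ix] /= ct //.
- by case: (ct Y false); constructor.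
1-6: by rewrite It ?Iu // => Y b o; apply: (ct Y); econstructor; exact: o.
- by rewrite It // => Y b o; apply: (ct Y b); constructor.
- congr op; apply: functional_extensionality => i; apply: Ix => Y b oi.
  by apply: (ct Y b); econstructor; exact: oi.
Qed.

(** The axiom sets list all their substitution instances, so an image is again an instance. The
    second disjunct covers [CM1'], whose premises must be carried along. *)
Lemma timage_pACP_ax (ga : commFun A) P l r : pACP_ax ga P l r ->
  pACP_ax ga noprem (timage l) (timage r) \/
  exists x y, P = idem (fun b : bool => if b then x else y) /\
  pACP_ax ga (idem (fun b : bool => if b then timage x else timage y))
    (timage l) (timage r).
Proof.
by case=> *; try (by left; constructor); right; eexists; eexists; split;
  [reflexivity | constructor].
Qed.

Lemma timage_SI_ax (ga : commFun A) (st : strategy M ga)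
    (emb : forall n, siop (cstate st) n -> O n) P l r : SI_ax emb P l r ->
  SI_ax (fun n o => f (emb n o)) noprem (timage l) (timage r) \/
  exists n (x : 'I_n -> term M A O), P = idem x /\
  SI_ax (fun n o => f (emb n o)) (idem (fun i => timage (x i)))
    (timage l) (timage r).
Proof.
have opE n (o : O n) x : timage (op o x) = op (f o) (fun i => timage (x i)) by [].
have seqE t u : timage (seqc t u) = seqc (timage t) (timage u) by [].
have altE t u : timage (alt t u) = alt (timage t) (timage u) by [].
have pchE p t u : timage (pch p t u) = pch p (timage t) (timage u) by [].
case=> {P l r}.
- by move=> n h s x e; right; exists n.+1, x; split=> //; apply: SI0'.
- move=> n h s x g e; right; exists n.+1, x; split=> //.
  by rewrite timage_bigpch; apply: SI1'.
- by move=> n i h s x; left; rewrite /psi opE timage_upd; apply: SI2.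
- by move=> i h s a pa; left; apply: SI3.
- move=> n i h s x a pa; left; rewrite /psi seqE !opE timage_upd.
  exact: (SI4 _ _ _ _ (fun j => timage (x j))).
- by move=> n i h s x a x' pa; left; rewrite /psi seqE !opE !timage_upd; apply: SI5.
- move=> n i h s x d; left; rewrite /psi seqE !opE timage_upd timage_append.
  rewrite timage_tmap_closed; last exact: crea_closed.
  exact: (SI6 _ _ _ _ (fun j => timage (x j))).
- move=> n i h s x d x'; left; rewrite /psi seqE !opE timage_upd timage_append.
  rewrite timage_upd timage_tmap_closed; last exact: crea_closed.
  exact: SI7.
- move=> n i h s x x' x''; left.
  by rewrite /psi altE !opE !timage_upd altE; apply: SI8.
- move=> n i h s x p x' x''; left.
  by rewrite /si pchE !opE !timage_upd pchE; apply: pSI1.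
- move=> n i h s x p x' x''; left.
  by rewrite /psi pchE !opE !timage_upd pchE; apply: pSI2.
Qed.

End Images.

(** * Terms over the recursion constants, and head normal forms *)

Section HeadNormalForms.
Variables (M : signedMeadow) (A : Type) (ga : commFun A) (st : strategy M ga).
Variables (E : pSI_spec st) (gE : pSI_guarded E).

Local Notation T := (term M A (sirop st)).
Local Notation SIR := (@SIRop M A ga st).
Local Notation D := (derivable (pACPpSIr_ax (st := st))).
Local Notation sih := (si (st := st) SIR).
Local Notation psih := (psi (st := st) SIR).
Local Notation actA a := (act (Some a)).
Local Open Scope proc_scope.

Inductive W : T -> Prop :=
| W_rec Y (vY : vars E Y) : W (rec_term gE vY)
| W_act a : W (act a)
| W_alt t u : W t -> W u -> W (t + u)
| W_seqc t u : W t -> W u -> W (t * u)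
| W_pch p t u : W t -> W u -> W (t <+{p} u)
| W_par t u : W t -> W u -> W (t ||| u)
| W_lmerge t u : W t -> W u -> W (t ||_ u)
| W_cmerge t u : W t -> W u -> W (t |&| u)
| W_encap H t : W t -> W (encap H t)
| W_op n (o : siop (cstate st) n) x : (forall i, W (x i)) -> W (op (SIR o) x).

Lemma W_upd n (x : 'I_n -> T) i u : (forall j, W (x j)) -> W u ->
  forall j, W (upd x i u j).
Proof. by move=> Wx Wu j; rewrite /upd; case: ifP. Qed.

Lemma W_append n (x : 'I_n -> T) u : (forall j, W (x j)) -> W u ->
  forall j, W (append x u j).
Proof. by move=> Wx Wu j; rewrite /append; case: unlift. Qed.

Lemma W_image (sg : nat -> T) (t : term M A (siop (cstate st))) :
  (forall Y b, occurs Y b t -> W (sg Y)) -> W (timage SIR sg t).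
Proof.
rewrite /timage; elim: t => [Y|a|t It u Iu|t It u Iu|p t It u Iu|t It u Iu
  |t It u Iu|t It u Iu|H t It|n o x Ix] /= ct.
- by apply: (ct Y false); constructor.
- by constructor.
1-6: by constructor; [apply: It|apply: Iu] => Y b o; apply: ct; econstructor; exact: o.
- by constructor; apply: It => Y b o; apply: ct; econstructor; exact: o.
- by apply: W_op => i; apply: Ix => Y b oi; apply: ct; econstructor; exact: oi.
Qed.

Lemma W_crea (d : data st) : W (tmap SIR (crea d)).
Proof.
(* The identity renaming puts [crea d] in the form that [timage_tmap_closed] expects; as no variable
   occurs, [delta] is an arbitrary choice from [W]. *)
have := @W_image (fun=> delta) (tmap (fun n o => o) (crea d)).
rewrite timage_tmap_closed; last exact: crea_closed.
by apply=> Y b _; constructor.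
Qed.

(* Only actions and prefixes are summed, so that [basic] terms are idempotent,
   as the conditional axioms [CM1'], [SI0'] and [SI1'] require. *)
Inductive basic : T -> Prop :=
| basic_act a : basic (act a)
| basic_pre a t : W t -> basic (actA a * t)
| basic_alt t u : basic t -> basic u -> basic (t + u).

Inductive hnf : T -> Prop :=
| hnf_basic t : basic t -> hnf t
| hnf_pch p t u : hnf t -> hnf u -> hnf (t <+{p} u).

Definition upto (P : T -> Prop) t := exists2 t', P t' & D t t'.

Lemma upto_eq P t u : D t u -> upto P u -> upto P t.
Proof. by move=> tu [v Pv uv]; exists v => //; apply: d_trans uv. Qed.

Lemma upto_refl (P : T -> Prop) t : P t -> upto P t.
Proof. by exists t => //; apply: d_refl. Qed.

Lemma upto_hnf t : upto basic t -> upto hnf t.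
Proof. by case=> u bu tu; exists u => //; apply: hnf_basic. Qed.

Lemma derive_pACP l r : pACP_ax ga noprem l r -> D l r.
Proof. by move=> h; apply: d_ax; [left; left; exact: h|]. Qed.

Lemma derive_SI l r : SI_ax SIR noprem l r -> D l r.
Proof. by move=> h; apply: d_ax; [left; right; exact: h|]. Qed.

Lemma upto_pACP P l r : pACP_ax ga noprem l r -> upto P r -> upto P l.
Proof. by move/derive_pACP; apply: upto_eq. Qed.

Lemma upto_SI P l r : SI_ax SIR noprem l r -> upto P r -> upto P l.
Proof. by move/derive_SI; apply: upto_eq. Qed.

Lemma upto_alt_basic t u : upto basic t -> upto basic u -> upto basic (t + u).
Proof.
by move=> [t' bt et] [u' bu eu]; exists (t' + u'); [constructor|apply: d_alt].
Qed.

Lemma upto_pch p t u : upto hnf t -> upto hnf u -> upto hnf (t <+{p} u).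
Proof.
by move=> [t' bt et] [u' bu eu]; exists (t' <+{p} u'); [constructor|apply: d_pch].
Qed.

(** A prefix by [delta] is not [basic], but it arises from encapsulation and failed communication;
    [A7] collapses it. *)
Lemma upto_prefix a t : W t -> upto basic (act a * t).
Proof.
case: a => [a|] Wt; first by apply: upto_refl; constructor.
by apply: (upto_pACP (A7 _ _)); apply: upto_refl; constructor.
Qed.

Lemma derive_altACA x y z w : D ((x + y) + (z + w)) ((x + z) + (y + w)).
Proof.
have A_ x' y' z' : D ((x' + y') + z') (x' + (y' + z')).
  by apply: derive_pACP; constructor.
have C_ x' y' : D (x' + y') (y' + x') by apply: derive_pACP; constructor.
apply: d_trans (A_ _ _ _) _; apply: d_sym; apply: d_trans (A_ _ _ _) _.
apply: d_alt (d_refl _ _) _; apply: d_trans (d_sym (A_ _ _ _)) _.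
by apply: d_trans (d_alt (C_ _ _) (d_refl _ _)) _; apply: A_.
Qed.

(** [A3'] settles single actions, [A4] reduces prefixes to them, and sums follow by rearranging the
    four summands. *)
Lemma basic_idem t : basic t -> D t (t + t).
Proof.
elim=> {t} [a|a t _|t u _ It _ Iu].
- by apply/d_sym/derive_pACP; constructor.
- apply: d_sym; apply: d_trans (d_sym (derive_pACP (A4 _ _ _ _))) _.
  by apply: d_seqc; [apply: derive_pACP; constructor | apply: d_refl].
- by apply: d_trans (d_alt It Iu) _; apply: derive_altACA.
Qed.

(** * Closure of head normal forms under the operators of pACP *)

Lemma hnf_alt t u : hnf t -> hnf u -> upto hnf (t + u).
Proof.
elim=> {t} [t bt|p t t' _ It _ It'] hu; last first.
  by apply: (upto_pACP (pA5 _ _ _ _ _)); apply: upto_pch; auto.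
elim: hu => {u} [u bu|p u u' _ Iu _ Iu'].
  by apply/upto_refl/hnf_basic/basic_alt.
(* [pA5] distributes over the left operand only, so [A1] moves the choice there and then restores
   the order in both branches. *)
apply: (upto_pACP (A1 _ _ _)); apply: (upto_pACP (pA5 _ _ _ _ _)).
by apply: upto_pch; apply: (upto_pACP (A1 _ _ _)).
Qed.

Lemma upto_alt t u : upto hnf t -> upto hnf u -> upto hnf (t + u).
Proof.
by move=> [t' ht et] [u' hu eu]; apply: (upto_eq (d_alt et eu)); apply: hnf_alt.
Qed.

(** The right operand only enters continuations, so membership in [W] suffices for it; the same
    holds for [upto_lmerge]. *)
Lemma upto_seqc t u : upto hnf t -> W u -> upto hnf (t * u).
Proof.
move=> [t' ht et] Wu; apply: (upto_eq (d_seqc et (d_refl _ u))).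
elim: ht {et} => {t' t} [t bt|p t t' _ It _ It']; last first.
  by apply: (upto_pACP (pA4 _ _ _ _ _)); apply: upto_pch.
apply: upto_hnf; elim: bt => {t} [a|a t Wt|t t' _ It _ It'].
- exact: upto_prefix.
- by apply: (upto_pACP (A5 _ _ _ _)); apply/upto_prefix/W_seqc.
- by apply: (upto_pACP (A4 _ _ _ _)); apply: upto_alt_basic.
Qed.

Lemma upto_encap H t : upto hnf t -> upto hnf (encap H t).
Proof.
move=> [t' ht et]; apply: (upto_eq (d_encap _ et)).
elim: ht {et} => {t' t} [t bt|p t t' _ It _ It']; last first.
  by apply: (upto_pACP (pD _ _ _ _ _)); apply: upto_pch.
have encap_act a : exists b, D (encap H (act a)) (act b).
  (* [H] is an arbitrary predicate, so membership is decided classically. *)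
  case: (classic (in_enc H a)) => Ha.
    by exists None; apply: derive_pACP; apply: D2.
  by exists a; apply: derive_pACP; apply: D1.
apply: upto_hnf; elim: bt => {t} [a|a t Wt|t t' _ It _ It'].
- by have [b eb] := encap_act a; exists (act b); first constructor.
- apply: (upto_pACP (D4 _ _ _ _)); have [b eb] := encap_act (Some a).
  by apply: (upto_eq (d_seqc eb (d_refl _ _))); apply/upto_prefix/W_encap.
- by apply: (upto_pACP (D3 _ _ _ _)); apply: upto_alt_basic.
Qed.

Lemma basic_lmerge t u : basic t -> W u -> upto basic (t ||_ u).
Proof.
move=> bt Wu; elim: bt => {t} [a|a t Wt|t t' _ It _ It'].
- by apply: (upto_pACP (CM2 _ _ _)); apply: upto_prefix.
- by apply: (upto_pACP (CM3 _ _ _ _)); apply/upto_prefix/W_par.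
- by apply: (upto_pACP (CM4 _ _ _ _)); apply: upto_alt_basic.
Qed.

Lemma upto_lmerge t u : upto hnf t -> W u -> upto hnf (t ||_ u).
Proof.
move=> [t' ht et] Wu; apply: (upto_eq (d_lmerge et (d_refl _ u))).
elim: ht {et} => {t' t} [t bt|p t t' _ It _ It'].
  exact/upto_hnf/basic_lmerge.
by apply: (upto_pACP (pCM3 _ _ _ _ _)); apply: upto_pch.
Qed.

Lemma basic_cmerge t u : basic t -> basic u -> upto basic (t |&| u).
Proof.
elim=> {t} [a|a t Wt|t t' _ It _ It'] bu; last first.
  by apply: (upto_pACP (CM8 _ _ _ _)); apply: upto_alt_basic; auto.
all: elim: bu => {u} [b|b u Wu|u u' _ Iu _ Iu'];
  try by apply: (upto_pACP (CM9 _ _ _ _)); apply: upto_alt_basic.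
- by apply: (upto_pACP (CM5 _ _ _ _)); apply: upto_prefix.
- by apply: (upto_pACP (CM7 _ _ _ _ _)); apply/upto_prefix/W_par.
- by apply: (upto_pACP (CM12 _ _ _ _ _)); apply: upto_refl; constructor.
- by apply: (upto_pACP (CM6 _ _ _ _)); apply: upto_prefix.
Qed.

Lemma upto_cmerge t u : upto hnf t -> upto hnf u -> upto hnf (t |&| u).
Proof.
move=> [t' ht et] [u' hu eu]; apply: (upto_eq (d_cmerge et eu)).
elim: ht {et} => {t' t} [t bt|p t t' _ It _ It']; last first.
  by apply: (upto_pACP (pCM5 _ _ _ _ _)); apply: upto_pch.
elim: hu {eu} => {u' u} [u bu|p u u' _ Iu _ Iu'].
  exact/upto_hnf/basic_cmerge.
by apply: (upto_pACP (pCM6 _ _ _ _ _)); apply: upto_pch.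
Qed.

Lemma basic_W t : basic t -> W t.
Proof. by elim=> *; repeat constructor. Qed.

(** [pCM1] and [pCM2] first push the choices outwards; the remaining operands are basic, hence
    idempotent, and [CM1'] applies. *)
Lemma upto_par t u : upto hnf t -> upto hnf u -> upto hnf (t ||| u).
Proof.
move=> [t' ht et] [u' hu eu]; apply: (upto_eq (d_par et eu)).
elim: ht {et} => {t' t} [t bt|p t t' _ It _ It']; last first.
  by apply: (upto_pACP (pCM1 _ _ _ _ _)); apply: upto_pch.
elim: hu {eu} => {u' u} [u bu|p u u' _ Iu _ Iu']; last first.
  by apply: (upto_pACP (pCM2 _ _ _ _ _)); apply: upto_pch.
have e : D (t ||| u) ((t ||_ u + u ||_ t) + t |&| u).
  apply: d_ax; first by left; left; apply: CM1'.
  by move=> _ _ [[] [-> ->]]; apply: basic_idem.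
apply: (upto_eq e); apply/upto_hnf/upto_alt_basic; last exact: basic_cmerge.
by apply: upto_alt_basic; apply: basic_lmerge => //; apply: basic_W.
Qed.

(** * Closure of head normal forms under strategic interleaving *)

Lemma derive_op_upd n (o : sirop st n) x i u :
  D (x i) u -> D (op o x) (op o (upd x i u)).
Proof.
by move=> xu; apply: d_op => j; rewrite /upd; case: eqP => [->|_] //; apply: d_refl.
Qed.

Lemma plainVpcr a : plain st a \/ exists d : data st, a = pcr d.
Proof.
case: (classic (exists d : data st, a = pcr d)) => [|np]; first by right.
by left=> d e; apply: np; exists d.
Qed.

Lemma basic_psi n i (h : history n.+1) s x v : (forall j, W (x j)) -> basic v ->
  upto basic (psih i h s (upd x i v)).
Proof.
move=> Wx; elim=> {v} [[a|]|a t Wt|t t' _ It _ It'].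
- case: (plainVpcr a) => [pa|[d ->]]; last first.
    apply: (upto_SI (SI6 _ _ _ _ _ _)); apply: upto_prefix; apply: W_op => j.
    by apply: W_append => [k|]; [apply: Wx | apply: W_crea].
  (* [SI4] removes a process, so it needs at least two of them; termination of the only process
     falls under [SI3]. *)
  case: n i h x Wx => [|n] i h x Wx; last first.
    apply: (upto_SI (SI4 _ _ _ _ _ pa)); apply: upto_prefix.
    by apply: W_op => j; apply: Wx.
  exists (actA a); first by constructor.
  apply: d_trans (derive_SI (SI3 SIR i h s pa)).
  by apply: d_op => j; rewrite /upd !ord1 eqxx; apply: d_refl.
- by apply: (upto_SI (SI2 _ _ _ _ _)); apply: upto_refl; constructor.
- case: (plainVpcr a) => [pa|[d ->]].
    apply: (upto_SI (SI5 _ _ _ _ _ _ pa)); apply: upto_prefix; apply: W_op.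
    exact: W_upd.
  apply: (upto_SI (SI7 _ _ _ _ _ _ _)); apply: upto_prefix; apply: W_op => j.
  by apply: W_append => [k|]; [apply: W_upd | apply: W_crea].
- by apply: (upto_SI (SI8 _ _ _ _ _ _ _)); apply: upto_alt_basic.
Qed.

(** Only the scheduled process makes a step; the others pass unchanged into the continuation. *)
Lemma upto_psi n i (h : history n.+1) s x : (forall j, W (x j)) ->
  upto hnf (x i) -> upto hnf (psih i h s x).
Proof.
move=> Wx [v hv xv]; apply: (upto_eq (derive_op_upd _ xv)).
elim: hv {xv} => {v} [v bv|p t t' _ It _ It'].
  exact/upto_hnf/basic_psi.
by apply: (upto_SI (pSI2 _ _ _ _ _ _ _ _)); apply: upto_pch.
Qed.

Lemma upto_bigpch n (w : 'I_n.+1 -> M) (t : 'I_n.+1 -> T) :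
  (forall i, upto hnf (t i)) -> upto hnf (bigpch w t).
Proof.
elim: n w t => [|n IHn] w t ht /=; first exact: ht.
by apply: upto_pch => //; apply: IHn => i; apply: ht.
Qed.

Lemma basic_si n (h : history n.+1) s x : (forall j, basic (x j)) ->
  upto hnf (sih h s x).
Proof.
move=> bx; have idx u v : idem x u v -> D u v.
  by case=> i [-> ->]; apply: basic_idem.
case e : (sched h s) => [f|].
  have eq := d_ax (Ax := pACPpSIr_ax (st := st)) (or_introl (or_intror (SI1' SIR x e))) idx.
  apply: (upto_eq eq); apply: upto_bigpch => i; apply: upto_psi => [j|].
    exact: basic_W.
  exact/upto_refl/hnf_basic.
have eq := d_ax (Ax := pACPpSIr_ax (st := st)) (or_introl (or_intror (SI0' SIR x e))) idx.
by apply: (upto_eq eq); apply/upto_refl/hnf_basic; constructor.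
Qed.

Lemma upto_si n (h : history n.+1) s x : (forall j, upto hnf (x j)) ->
  upto hnf (sih h s x).
Proof.
(* The list [l] holds the positions whose arguments may still be probabilistic choices; [pSI1]
   clears them one position at a time, until [SI0'] or [SI1'] applies. *)
suff H (l : seq 'I_n.+1) y : (forall j, upto hnf (y j)) ->
    (forall j, j \notin l -> basic (y j)) -> upto hnf (sih h s y).
  by move=> hx; apply: (H (enum 'I_n.+1)) => // j; rewrite mem_enum.
elim: l y => [|i l IHl] y hy yb; first by apply: basic_si => j; apply: yb.
have [v hv yv] := hy i; apply: (upto_eq (derive_op_upd _ yv)).
elim: hv {yv} => {v} [v bv|p t t' _ It _ It']; last first.
  by apply: (upto_SI (pSI1 _ _ _ _ _ _ _ _)); apply: upto_pch.
apply: IHl => j; rewrite /upd; case: eqP => //.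
  by move=> _; apply/upto_refl/hnf_basic.
by move=> /eqP ji jl; apply: yb; rewrite inE negb_or ji.
Qed.

Lemma upto_op n (o : siop (cstate st) n) x : (forall j, W (x j)) ->
  (forall j, upto hnf (x j)) -> upto hnf (op (SIR o) x).
Proof.
by case: o x => [k h s|k i h s] x Wx hx; [apply: upto_si | apply: upto_psi].
Qed.

(** * Head normal forms of the recursion constants, from guardedness *)

(* Rewriting a right-hand side of [E] may introduce variables that [E] does not
   define; they are closed off with [delta]. *)
Definition solution (Y : nat) : T :=
  (if vars E Y as b return vars E Y = b -> T
   then fun vY => rec_term gE vY
   else fun _ => delta) (erefl _).

Lemma solution_vars Y (vY : vars E Y) : solution Y = rec_term gE vY.
Proof.
(* The tested boolean is generalized together with its equality proof; such proofs are unique on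
   booleans. *)
rewrite /solution; move: (erefl (vars E Y)); move: {2 3}(vars E Y) => b e.
case: b e => e; last by rewrite vY in e.
by rewrite (eq_irrelevance e vY).
Qed.

Lemma W_solution Y : W (solution Y).
Proof.
case vY : (vars E Y); first by rewrite (solution_vars vY); constructor.
rewrite /solution; move: (erefl (vars E Y)); move: {2 3}(vars E Y) => b.
by case: b => e; constructor.
Qed.

Local Notation img := (timage SIR solution).

Lemma W_img t : W (img t).
Proof. by apply: W_image => Y b _; apply: W_solution. Qed.

(** The induction never meets a variable: guarded occurrences lie in right operands of sequential
    compositions, where membership in [W] is enough. In the operands visited, every occurrence keeps
    its guardedness flag. *)
Lemma upto_img_guarded t : guarded t -> upto hnf (img t).
Proof.
have sub_guarded (u v : term M A (siop (cstate st))) : guarded u ->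
    (forall Y g, occurs Y g v -> occurs Y g u) -> guarded v.
  by move=> gu uv Y g /uv; apply: gu.
elim: t => [Y|a|t It u Iu|t It u Iu|p t It u Iu|t It u Iu|t It u Iu|t It u Iu
  |H t It|n o x Ix] gt.
- by have := gt Y false (occ_var _ _ _ _).
- by apply/upto_refl/hnf_basic; constructor.
- by apply: upto_alt; [apply: It|apply: Iu]; apply: sub_guarded gt _ => Y g ?;
    constructor.
- apply: upto_seqc; last exact: W_img.
  by apply: It; apply: sub_guarded gt _ => Y g ?; constructor.
- by apply: upto_pch; [apply: It|apply: Iu]; apply: sub_guarded gt _ => Y g ?;
    constructor.
- by apply: upto_par; [apply: It|apply: Iu]; apply: sub_guarded gt _ => Y g ?;
    constructor.
- apply: upto_lmerge; last exact: W_img.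
  by apply: It; apply: sub_guarded gt _ => Y g ?; constructor.
- by apply: upto_cmerge; [apply: It|apply: Iu]; apply: sub_guarded gt _ => Y g ?;
    constructor.
- by apply/upto_encap/It; apply: sub_guarded gt _ => Y g ?; constructor.
- apply: upto_op => j; first exact: W_img.
  by apply: Ix; apply: sub_guarded gt _ => Y g oj; econstructor; exact: oj.
Qed.

Lemma img_derivable t u :
  derivable (pACPpSI_ax (st := st) (fun n o => o)) t u -> D (img t) (img u).
Proof.
elim=> {t u}.
- by move=> t; apply: d_refl.
- by move=> t u _; apply: d_sym.
- by move=> t u v _ h1 _; apply: d_trans h1.
- by move=> t t' u u' _ h1 _; apply: d_alt.
- by move=> t t' u u' _ h1 _; apply: d_seqc.
- by move=> p t t' u u' _ h1 _; apply: d_pch.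
- by move=> t t' u u' _ h1 _; apply: d_par.
- by move=> t t' u u' _ h1 _; apply: d_lmerge.
- by move=> t t' u u' _ h1 _; apply: d_cmerge.
- by move=> H t t' _; apply: d_encap.
- by move=> n o x y _ h; apply: d_op.
move=> P l r [] ax _ IH.
- case: (timage_pACP_ax SIR solution ax) => [|[x [y [eP ax']]]].
    exact: derive_pACP.
  apply: d_ax (or_introl (or_introl ax')) _ => _ _ [b [-> ->]].
  have := IH (if b then x else y) (alt (if b then x else y) (if b then x else y)).
  by rewrite eP; case: b; apply; [exists true|exists false].
- case: (timage_SI_ax SIR solution ax) => [|[n [x [eP ax']]]].
    exact: derive_SI.
  apply: d_ax (or_introl (or_intror ax')) _ => _ _ [i [-> ->]].
  by apply: (IH (x i) (alt (x i) (x i))); rewrite eP; exists i.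
Qed.

Lemma img_subst1 c z t u : D (img t) (img u) ->
  D (img (tsubst (subst1 z t) c)) (img (tsubst (subst1 z u) c)).
Proof.
move=> tu; elim: c => [Y|a|? ? ? ?|? ? ? ?|p ? ? ? ?|? ? ? ?|? ? ? ?|? ? ? ?
  |H ? ?|n o x Ix].
- by rewrite /= /subst1; case: eqP => // _; apply: d_refl.
- exact: d_refl.
- exact: d_alt.
- exact: d_seqc.
- exact: d_pch.
- exact: d_par.
- exact: d_lmerge.
- exact: d_cmerge.
- exact: d_encap.
- exact: d_op.
Qed.

Lemma img_rec_subst t : (forall Y g, occurs Y g t -> vars E Y) ->
  D (rec_subst gE t) (img t).
Proof.
elim: t => [Y|a|t It u Iu|t It u Iu|p t It u Iu|t It u Iu|t It u Iu|t It u Iu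
  |H t It|n o x Ix] ct; rewrite /rec_subst /=.
- have vY := ct Y false (occ_var _ _ _ _).
  rewrite /timage /= (solution_vars vY).
  move: (erefl (vars E Y)); move: {2 3}(vars E Y) => b e.
  case: b e => e; last by rewrite vY in e.
  by rewrite (eq_irrelevance e vY); apply: d_refl.
- exact: d_refl.
1-6: by constructor; [apply: It|apply: Iu] => Y b o; apply: ct; econstructor; exact: o.
- by constructor; apply: It => Y b o; apply: ct; econstructor; exact: o.
- by apply: d_op => i; apply: Ix => Y b oi; apply: ct; econstructor; exact: oi.
Qed.

Lemma solution_eq Y t : E Y = Some t -> D (solution Y) (img t).
Proof.
move=> EY; have vY : vars E Y by rewrite /vars EY.
rewrite (solution_vars vY); apply: (d_trans (u := rec_subst gE t)).
  by apply: d_ax; first (right; exact: (RDP gE vY EY)).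
by apply: img_rec_subst; case: gE => rE _; apply: rE EY.
Qed.

Lemma img_rewrites Y t u :
  rewrites (pACPpSI_ax (st := st) (fun n o => o)) E Y t u -> D (img t) (img u).
Proof.
elim=> {t u} [t u|c z Z t _ EZ|t u v _ h1 _].
- exact: img_derivable.
- by apply: img_subst1; apply: solution_eq.
- exact: d_trans.
Qed.

(** Under [solution], the rewriting that makes a right-hand side guarded becomes a derivation, each
    use of an equation of [E] being justified by [RDP]. *)
Lemma upto_rec Y (vY : vars E Y) : upto hnf (rec_term gE vY).
Proof.
rewrite -solution_vars; move: vY; rewrite /vars; case EY : (E Y) => [t|//] _.
have [u tu gu] := gE.2 _ _ EY.
apply: upto_eq (solution_eq EY) _; apply: upto_eq (img_rewrites tu) _.
exact: upto_img_guarded.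
Qed.

Lemma upto_W t : W t -> upto hnf t.
Proof.
elim=> {t} => *.
- exact: upto_rec.
- by apply/upto_refl/hnf_basic; constructor.
- exact: upto_alt.
- exact: upto_seqc.
- exact: upto_pch.
- exact: upto_par.
- exact: upto_lmerge.
- exact: upto_cmerge.
- exact: upto_encap.
- exact: upto_op.
Qed.

(** * Skeletons of head normal forms *)

Local Notation Wterm := {t | W t}.
Local Notation lift_term u := (tmap SIR (tmap (@noopE (siop (cstate st))) u)).

(* The continuations of [t] are listed, with repetitions, by [k]; the number [n]
   of a continuation is encoded as the variable [f n] in the skeleton [u].  *)
Definition has_skeleton t := exists k : nat -> Wterm, forall f : nat -> nat,
  exists2 u : term M A noop, guarded u & forall K : nat -> T,
    (forall n, K (f n) = sval (k n)) -> t = tsubst K (lift_term u).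

Lemma skeleton_binary (c : forall O, term M A O -> term M A O -> term M A O) t u :
  (forall v w : term M A noop, guarded v -> guarded w -> guarded (c _ v w)) ->
  (forall K (v w : term M A noop), c _ (tsubst K (lift_term v)) (tsubst K (lift_term w)) =
     tsubst K (lift_term (c _ v w))) ->
  has_skeleton t -> has_skeleton u -> has_skeleton (c _ t u).
Proof.
move=> gc ec [k1 H1] [k2 H2].
(* Even numbers list the continuations of [t], odd numbers those of [u]. *)
exists (fun n => if odd n then k2 n./2 else k1 n./2) => f.
have [v gv ev] := H1 (fun n => f n.*2); have [w gw ew] := H2 (fun n => f n.*2.+1).
exists (c _ v w); first exact: gc.
move=> K eK; rewrite -ec -ev -?ew // => n; rewrite eK /= odd_double //=.
  by rewrite uphalf_double.
by rewrite doubleK.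
Qed.

Lemma hnf_skeleton t : hnf t -> has_skeleton t.
Proof.
elim=> {t} [t bt|p t u _ It _ Iu]; last first.
  apply: (@skeleton_binary (fun O => @pch M A O p)) It Iu => // v w gv gw Y g o.
  by inversion o; subst; [apply: (gv Y)|apply: (gw Y)].
elim: bt => {t} [a|a t Wt|t u _ It _ Iu]; last first.
- apply: (@skeleton_binary (fun O => @alt M A O)) It Iu => // v w gv gw Y g o.
  by inversion o; subst; [apply: (gv Y)|apply: (gw Y)].
(* The only continuation is repeated at every number, and number 0 is the one used. *)
- exists (fun=> exist _ t Wt) => f; exists (actA a * var (f 0)).
    by move=> Y g o; inversion o as [| | |? ? ? o'| | | | | | | | | | |] => //;
      inversion o'.
  by move=> K eK; rewrite /= eK.
(* There is no continuation; [delta] merely fills the list. *)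
- exists (fun=> exist _ delta (W_act None)) => f; exists (act a) => //.
  by move=> Y g o; inversion o.
Qed.

(** The listing [k] is chosen before the numbering [f], so that paths through [k] can be formed
    first and variables assigned to them afterwards. *)
Lemma skeletons : exists k : Wterm -> nat -> Wterm, forall (w : Wterm) (f : nat -> nat),
  exists2 u : term M A noop, guarded u & forall K : nat -> T,
    (forall n, K (f n) = sval (k w n)) -> D (sval w) (tsubst K (lift_term u)).
Proof.
apply: (functional_choice (fun (w : Wterm) (k : nat -> Wterm) => forall f : nat -> nat,
  exists2 u : term M A noop, guarded u & forall K : nat -> T,
    (forall n, K (f n) = sval (k n)) -> D (sval w) (tsubst K (lift_term u)))).
move=> [t Wt]; have [t' /hnf_skeleton [k Hk] tt'] := upto_W Wt; exists k => f.
by have [u gu eu] := Hk f; exists u => // K eK; rewrite -(eu K eK).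
Qed.

End HeadNormalForms.

(** * The recursive specification over pACP *)

Theorem theorem4 (M : signedMeadow) (A : Type) (ga : commFun A)
    (st : strategy M ga) (E : pSI_spec st) (gE : pSI_guarded E)
    (X : nat) (vX : vars E X) :
  exists (E' : pACP_spec M A) (gE' : pACP_guarded ga E') (vX' : vars E' X),
    derivable (pACPpSIr_ax (st := st))
      (rec_term gE vX)
      (rec_term (embed_guarded st gE') (vars_embed st vX')).
Proof.
have [k Hk] := skeletons gE.
pose node := foldl k (exist _ _ (W_rec gE vX)).
(* The path [p] has the number [X + CodeSeq.code p]; thus [X] is the root. *)
pose sg Y := sval (node (CodeSeq.decode (Y - X))).
have skel Y : exists u : term M A noop, guarded u /\
    derivable (pACPpSIr_ax (st := st)) (sg Y)
      (tsubst sg (tmap (@SIRop _ _ _ st) (tmap (@noopE (siop (cstate st))) u))).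
  set p := CodeSeq.decode (Y - X).
  (* Continuation [n] of the node at [p] is the node at [rcons p n], so it is named by the number of
     that path. *)
  have [u gu eu] := Hk (node p) (fun n => X + CodeSeq.code (rcons p n))%N.
  exists u; split=> //; apply: eu => n.
  by rewrite /sg addKn CodeSeq.codeK /node foldl_rcons.
have [body Hbody] := functional_choice _ skel.
(* Every number gets an equation; those below [X] stand for the root again, since the subtraction in
   [sg] is truncated at 0. *)
pose E' : pACP_spec M A := fun Y => Some (body Y).
have gE' : pACP_guarded ga E'.
  split=> // Y _ [<-]; exists (body Y); last by case: (Hbody Y).
  exact/rw_ax/d_refl.
have vX' : vars E' X by [].
exists E', gE', vX'.
have -> : rec_term gE vX = sg X by rewrite /sg subnn.
(* The family [sg] solves [E'] by the choice of [body], so [RSP] identifies its value at [X] with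
   the recursion constant. *)
apply: d_ax; first by right; apply: (RSP _ _ sg).
by move=> _ _ [Y [_ [[<-] -> ->]]]; case: (Hbody Y).
Qed.
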